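(* Let $\mathsf C(t) = (E+\alpha t\,\mathsf C_0A^T\Gamma^{-1}A)^{-1}\mathsf C_0$, $t\ge 0$, denote the solution of $\dot{\mathsf C}(t) = -\alpha\,\mathsf C(t)A^T\Gamma^{-1}A\,\mathsf C(t)$ with $\mathsf C(0)=\mathsf C_0$. Then the following hold. (i) The matrix $\mathsf C_0A^T\Gamma^{-1}A$ is diagonalizable, meaning that $\mathsf C_0A^T\Gamma^{-1}A = SDS^{-1}$ for some invertible $S\in\mathbb R^{n\times n}$ and $D=\operatorname{diag}(\mu_1,\dots,\mu_k,0,\dots,0)$, where $\mu_1\ge\cdots\ge\mu_k>0$ for some $k\le n$. (ii) With $\mu_i:=0$ for $i>k$, let $E(t):=\operatorname{diag}\left(\frac{1}{1+\alpha t\mu_i}\right)_{i=1}^n$ and $D(t):=DE(t)=\operatorname{diag}\left(\frac{\mu_i}{1+\alpha t\mu_i}\right)_{i=1}^n$. Then for all $t\ge0$ $$\mathsf C(t)=SE(t)S^{-1}\mathsf C_0,\qquad \mathsf C(t)A^T\Gamma^{-1}A = SD(t)S^{-1},\qquad \mathsf C_0A^T\Gamma^{-1}A\,\mathsf C(t)=SD(t)S^{-1}\mathsf C_0 .$$ (iii) The limit $\mathsf C_\infty:=\lim_{t\to\infty}\mathsf C(t)$ exists and equals $SE_\infty S^{-1}\mathsf C_0$, where $E_\infty=\operatorname{diag}(0,\dots,0,1,\dots,1)$ has $k$ zero entries followed by $n-k$ entries equal to one, and it satisfies $A\,\mathsf C_\infty=0$.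
   Context: $A\in\mathbb R^{m\times n}$; $\Gamma\in\mathbb R^{m\times m}$ is symmetric positive definite; $\mathsf C_0\in\mathbb R^{n\times n}$ is symmetric positive definite; $\alpha>0$ is a parameter; $E$ denotes the identity matrix in $\mathbb R^{n\times n}$. *)

(* Defs.v *)
From HB Require Import structures.
From mathcomp Require Import all_boot all_order all_algebra.
From mathcomp Require Import all_classical all_reals all_analysis.

Set Implicit Arguments.
Unset Strict Implicit.
Unset Printing Implicit Defensive.

Import Order.TTheory GRing.Theory Num.Theory.
Import numFieldNormedType.Exports.

Local Open Scope classical_set_scope.
Local Open Scope ring_scope.

Definition spdmx (R : realType) (n : nat) (M : 'M[R]_n) : Prop :=
  M^T = M /\ forall v : 'cV[R]_n, v != 0 -> 0 < (v^T *m M *m v) 0 0.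

Definition infomx (R : realType) (m n : nat) (A : 'M[R]_(m, n))
    (Gamma : 'M[R]_m) : 'M[R]_n :=
  A^T *m invmx Gamma *m A.

Definition cov_denom (R : realType) (m n : nat) (A : 'M[R]_(m, n))
    (Gamma : 'M[R]_m) (C0 : 'M[R]_n) (alpha t : R) : 'M[R]_n :=
  1%:M + (alpha * t) *: (C0 *m infomx A Gamma).

(* [invmx] is the identity on singular matrices, so this is the intended
   formula only where [cov_denom] is a unit. *)
Definition cov (R : realType) (m n : nat) (A : 'M[R]_(m, n))
    (Gamma : 'M[R]_m) (C0 : 'M[R]_n) (alpha t : R) : 'M[R]_n :=
  invmx (cov_denom A Gamma C0 alpha t) *m C0.

(* The initial value problem is posed on [0, +oo[ only: the derivative at 0 is
   one-sided and the values of [X] at negative times are irrelevant. *)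
Definition riccati_solution (R : realType) (m n : nat) (A : 'M[R]_(m, n))
    (Gamma : 'M[R]_m) (C0 : 'M[R]_n) (alpha : R) (X : R -> 'M[R]_n) : Prop :=
  let rhs (Y : 'M[R]_n) : 'M[R]_n :=
    - (alpha *: (Y *m infomx A Gamma *m Y)) in
  [/\ X 0 = C0,
      h^-1 *: (X h - X 0) @[h --> (0 : R)^'+] --> rhs (X 0) &
      forall t : R, 0 < t -> is_derive t (1 : R) X (rhs (X t))].

(* [mu] lists mu_1 >= ... >= mu_k > 0 followed by n - k zeros; the indices are
   0-based, so mu_(i+1) is [mu 0 i]. *)
Definition sorted_spectrum (R : realType) (n k : nat) (mu : 'rV[R]_n) : Prop :=
  [/\ (k <= n)%N,
      forall i j : 'I_n, (i <= j)%N -> (j < k)%N -> mu 0 j <= mu 0 i,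
      forall i : 'I_n, (i < k)%N -> 0 < mu 0 i &
      forall i : 'I_n, (k <= i)%N -> mu 0 i = 0].

Definition sorted_diagonalization (R : realType) (n : nat) (M S : 'M[R]_n)
    (k : nat) (mu : 'rV[R]_n) : Prop :=
  [/\ S \in unitmx, sorted_spectrum k mu & M = S *m diag_mx mu *m invmx S].

Definition Emx (R : realType) (n : nat) (alpha : R) (mu : 'rV[R]_n) (t : R) :
    'M[R]_n :=
  diag_mx (\row_i (1 + alpha * t * mu 0 i)^-1).

Definition Dmx (R : realType) (n : nat) (alpha : R) (mu : 'rV[R]_n) (t : R) :
    'M[R]_n :=
  diag_mx mu *m Emx alpha mu t.

Definition Einfmx (R : realType) (n k : nat) : 'M[R]_n :=
  diag_mx (\row_(i < n) (k <= i)%N%:R).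

(* Main.v *)
(* Put H = A^T Gamma^-1 A and M = C0 H.  M is self-adjoint for the inner product
   given by C0, so its complex eigenvalues are real and its minimal polynomial
   has no repeated root; hence M = S D S^-1, and D >= 0 since H >= 0.  In the
   basis S the formula for C(t) becomes diagonal, which reduces the identities,
   the Riccati equation and the limit to scalars.  H annihilates S E_oo, and so
   does A because Gamma^-1 is positive definite.  For uniqueness, if X solves the
   Riccati equation then W = (1 + alpha t M) X - C0 solves the linear equation
   W' = - alpha W H X with W(0) = 0, and Gronwall's inequality for the sum of the
   squared entries of W gives W = 0. *)
Require Import Defs.
From HB Require Import structures.
From mathcomp Require Import all_boot all_order all_algebra.
From mathcomp Require Import all_classical all_reals all_analysis.
From mathcomp Require Import complex ring lra perm.

Set Implicit Arguments.
Unset Strict Implicit.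
Unset Printing Implicit Defensive.

Import Order.TTheory GRing.Theory Num.Theory.
Import numFieldNormedType.Exports.

Local Open Scope classical_set_scope.
Local Open Scope ring_scope.

(** * Positive definite forms and the matrix [infomx A Gamma] *)

Lemma spdmx_row (R : realType) n (P : 'M[R]_n) (u : 'rV[R]_n) :
  spdmx P -> u != 0 -> 0 < (u *m P *m u^T) 0 0.
Proof.
case=> _ Ppos u0; rewrite -{1}[u]trmxK; apply: Ppos.
by rewrite -(inj_eq trmx_inj) trmxK trmx0.
Qed.

Lemma spdmx_row_ge0 (R : realType) n (P : 'M[R]_n) (u : 'rV[R]_n) :
  spdmx P -> 0 <= (u *m P *m u^T) 0 0.
Proof.
move=> Pspd; have [->|u0] := eqVneq u 0; first by rewrite !mul0mx mxE.
exact/ltW/spdmx_row.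
Qed.

Lemma spdmx_row_eq0 (R : realType) n (P : 'M[R]_n) (u : 'rV[R]_n) :
  spdmx P -> (u *m P *m u^T) 0 0 = 0 -> u = 0.
Proof.
move=> Pspd uPu; apply/eqP/negPn/negP => /(spdmx_row Pspd).
by rewrite uPu ltxx.
Qed.

Lemma spdmx_unit (R : realType) n (P : 'M[R]_n) : spdmx P -> P \in unitmx.
Proof.
move=> Pspd; rewrite -row_free_unit -kermx_eq0; apply/rowV0P => u.
move=> /sub_kermxP uP.
by apply: (spdmx_row_eq0 Pspd); rewrite uP mul0mx mxE.
Qed.

(** By symmetry, the form of [invmx P] at [v] equals the form of [P] at [invmx P *m v]. *)
Lemma spdmx_inv (R : realType) n (P : 'M[R]_n) : spdmx P -> spdmx (invmx P).
Proof.
move=> Pspd; have Pu := spdmx_unit Pspd; have [Psym _] := Pspd.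
split=> [|v v0]; first by rewrite trmx_inv Psym.
have -> : v^T *m invmx P *m v
    = (v^T *m invmx P) *m P *m (v^T *m invmx P)^T.
  by rewrite mulmxKV// trmx_mul trmxK trmx_inv Psym mulmxA.
apply: spdmx_row => //; apply: contra v0 => /eqP vP.
by rewrite -(inj_eq trmx_inj) trmx0 -[v^T](mulmxKV Pu) vP mul0mx.
Qed.

Section GramMatrix.
Variables (R : realType) (m n : nat) (A : 'M[R]_(m, n)) (Gamma : 'M[R]_m).
Hypothesis Gspd : spdmx Gamma.

Lemma infomx_sym : (infomx A Gamma)^T = infomx A Gamma.
Proof.
have [Gsym _] := spdmx_inv Gspd.
by rewrite /infomx !trmx_mul trmxK Gsym mulmxA.
Qed.

Lemma infomx_row_ge0 (u : 'rV[R]_n) : 0 <= (u *m infomx A Gamma *m u^T) 0 0.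
Proof.
have -> : u *m infomx A Gamma *m u^T
    = (u *m A^T) *m invmx Gamma *m (u *m A^T)^T.
  by rewrite /infomx trmx_mul trmxK !mulmxA.
exact/spdmx_row_ge0/spdmx_inv.
Qed.

(** For each column y of [Y], the vanishing of y^T H y = (A y)^T Gamma^-1 (A y) forces A y = 0. *)
Lemma infomx_mul_eq0 p (Y : 'M[R]_(n, p)) :
  infomx A Gamma *m Y = 0 -> A *m Y = 0.
Proof.
move=> HY; apply: trmx_inj; rewrite trmx0; apply/row_matrixP => j.
rewrite row0; apply: (spdmx_row_eq0 (spdmx_inv Gspd)).
rewrite -row_mul tr_row trmxK; set y := col j _.
have -> : row j ((A *m Y)^T *m invmx Gamma) *m y
    = row j (Y^T *m (infomx A Gamma *m Y)) *m delta_mx j 0.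
  by rewrite /y colE /infomx trmx_mul -!row_mul !mulmxA.
by rewrite HY mulmx0 row0 mul0mx mxE.
Qed.

End GramMatrix.

(** * Real spectrum and diagonalizability of self-adjoint matrices *)

(* [P *m H] is self-adjoint for the inner product [u *m P *m v^T] on rows. *)
Section SelfAdjoint.
Variables (R : realType) (n : nat) (P H : 'M[R]_n).
Hypotheses (Pspd : spdmx P) (Hsym : H^T = H).
Let M := P *m H.

Lemma selfadjoint_form (u v : 'rV[R]_n) :
  (u *m M *m P *m v^T) 0 0 = (v *m M *m P *m u^T) 0 0.
Proof.
have [Psym _] := Pspd.
rewrite -[in LHS](trmxK (u *m M *m P *m v^T)) [LHS]mxE /M.
by rewrite !trmx_mul trmxK Psym Hsym !mulmxA.
Qed.

(** With N = M - r, self-adjointness reads P N^T = N P, so the squared [P]-norm of u N is u N N P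
    u^T = 0. This excludes nontrivial Jordan blocks. *)
Lemma selfadjoint_sqr_eq0 (r : R) (u : 'rV[R]_n) :
  u *m (M - r%:M) *m (M - r%:M) = 0 -> u *m (M - r%:M) = 0.
Proof.
have [Psym _] := Pspd => uMM; apply: (spdmx_row_eq0 Pspd).
have PM : P *m (M - r%:M)^T = (M - r%:M) *m P.
  rewrite linearB /= tr_scalar_mx mulmxBr mulmxBl /M trmx_mul Psym Hsym mulmxA.
  by rewrite mul_mx_scalar mul_scalar_mx.
rewrite trmx_mul -(mulmxA (u *m _)) (mulmxA P) PM !mulmxA uMM.
by rewrite !mul0mx mxE.
Qed.

(** Split the eigenvector into a + ib and the eigenvalue into x + iy: then aM = xa - yb and bM = xb
    + ya. Comparing the form at (a, b) and at (b, a) leaves y times the sum of the squared [P]-norms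
    of a and b equal to 0, and a, b are not both zero. *)
Lemma selfadjoint_eigenvalue_real (z : R[i]) :
  eigenvalue (map_mx (real_complex R) M) z -> z = (complex.Re z)%:C%C.
Proof.
move=> /eigenvalueP[v vM v0].
pose a := map_mx (@complex.Re R) v; pose b := map_mx (@complex.Im R) v.
have ReD : {morph @complex.Re R : x y / x + y} by case=> ? ? [? ?].
have ImD : {morph @complex.Im R : x y / x + y} by case=> ? ? [? ?].
have aM : a *m M = map_mx (@complex.Re R) (z *: v).
  rewrite -vM; apply/rowP => j; rewrite !mxE (big_morph _ ReD (erefl _)).
  by apply: eq_bigr => k _; rewrite !mxE; case: (v 0 k) => x y /=;
    rewrite mulr0 subr0.
have bM : b *m M = map_mx (@complex.Im R) (z *: v).
  rewrite -vM; apply/rowP => j; rewrite !mxE (big_morph _ ImD (erefl _)).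
  by apply: eq_bigr => k _; rewrite !mxE; case: (v 0 k) => x y /=;
    rewrite mulr0 add0r.
case: z vM aM bM => x y _ aM bM; suff -> : y = 0 by [].
have {}aM : a *m M = x *: a + - y *: b.
  by rewrite aM; apply/rowP => j; rewrite !mxE mulNr; case: (v 0 j).
have {}bM : b *m M = x *: b + y *: a.
  by rewrite bM; apply/rowP => j; rewrite !mxE; case: (v 0 j).
have sym : (a *m P *m b^T) 0 0 = (b *m P *m a^T) 0 0.
  have [Psym _] := Pspd.
  rewrite -[in LHS](trmxK (a *m P *m b^T)) [LHS]mxE.
  by rewrite !trmx_mul trmxK Psym !mulmxA.
have formE c1 c2 (u1 u2 : 'rV[R]_n) w : ((c1 *: u1 + c2 *: u2) *m P *m w) 0 0
    = c1 * (u1 *m P *m w) 0 0 + c2 * (u2 *m P *m w) 0 0.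
  by rewrite !mulmxDl -!scalemxAl mxE [X in X + _]mxE [X in _ + X]mxE.
have := selfadjoint_form a b; rewrite aM bM !formE sym => /addrI /eqP.
rewrite mulNr eq_sym -subr_eq0 opprK -mulrDr mulf_eq0 => /orP[/eqP//|ab0].
have ge0a := spdmx_row_ge0 a Pspd; have ge0b := spdmx_row_ge0 b Pspd.
move: ab0; rewrite paddr_eq0// => /andP[/eqP b0 /eqP a0].
move: v0; rewrite (_ : v = 0) ?eqxx//; apply/rowP => j; rewrite mxE.
move/(spdmx_row_eq0 Pspd)/rowP/(_ j) : a0; rewrite !mxE.
move/(spdmx_row_eq0 Pspd)/rowP/(_ j) : b0; rewrite !mxE.
by case: (v 0 j) => /= ? ? -> ->.
Qed.

End SelfAdjoint.

(* A repeated root r would leave a nonzero row u of q(M) with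
   u (M - r)^2 = 0 <> u (M - r), against self-adjointness. *)
Lemma selfadjoint_diagonalizable (R : realType) (n : nat) (P H : 'M[R]_n) :
  spdmx P -> H^T = H ->
  exists (S : 'M[R]_n) (mu : 'rV[R]_n),
    S \in unitmx /\ P *m H = S *m diag_mx mu *m invmx S.
Proof.
move=> Pspd Hsym; set M := P *m H.
case: n => [|n] in P H Pspd Hsym M *.
  by exists 1%:M, 0; split; [exact: unitmx1|rewrite [M]thinmx0 [RHS]thinmx0].
(* The minimal polynomial splits over the complex numbers, and its roots are eigenvalues, hence
   real; the factorization therefore descends to [R]. *)
have [rs mP] : exists rs : seq R, mxminpoly M = \prod_(r <- rs) ('X - r%:P).
  have [zs] := closed_field_poly_normal (mxminpoly (map_mx (real_complex R) M)).
  rewrite (monicP (mxminpoly_monic _)) scale1r => zsE.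
  exists [seq complex.Re z | z <- zs].
  apply: (map_poly_inj (real_complex R)).
  rewrite -mxminpoly_map zsE map_prod_XsubC big_map.
  apply: eq_big_seq => z z_zs; congr ('X - _%:P).
  apply: (selfadjoint_eigenvalue_real Pspd Hsym).
  by rewrite eigenvalue_root_min zsE root_prod_XsubC.
have rs_uniq : uniq rs.
  apply: count_mem_uniq => r; have [r_rs|] := boolP (r \in rs); last first.
    by move/count_memPn.
  have rsE := perm_to_rem r_rs; rewrite (seq.permP rsE) /= eqxx add1n.
  have [r_rem|/count_memPn->//] := boolP (r \in rem r rs).
  exfalso; have remE := perm_to_rem r_rem.
  pose q := \prod_(x <- rem r (rem r rs)) ('X - x%:P).
  have q0 : q != 0 by exact/monic_neq0/monic_prod_XsubC.
  have pE : mxminpoly M = q * ('X - r%:P) * ('X - r%:P).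
    rewrite mP (perm_big _ rsE) big_cons (perm_big _ remE) big_cons /=.
    by rewrite -/q mulrA mulrC mulrA.
  have hX : horner_mx M ('X - r%:P) = M - r%:M.
    by rewrite rmorphB /= horner_mx_X horner_mx_C.
  (* This polynomial annihilates [M], yet its degree is one less than that of the minimal
     polynomial. *)
  have : mxminpoly M %| q * ('X - r%:P).
    apply: mxminpoly_min; rewrite rmorphM /= hX.
    apply/row_matrixP => i; rewrite row0 row_mul.
    apply: (selfadjoint_sqr_eq0 Pspd Hsym).
    have := mx_root_minpoly M; rewrite pE !rmorphM /= !hX => qMM.
    by rewrite -!row_mul [X in row i X]qMM row0.
  have qX0 : q * ('X - r%:P) != 0 by rewrite mulf_neq0 ?polyXsubC_eq0.
  move=> /(dvdp_leq qX0).
  rewrite pE [X in (X <= _)%N]size_Mmonic ?monicXsubC//.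
  by rewrite size_XsubC addn2 ltnn.
have [S Su SP] : diagonalizable M.
  by apply/diagonalizableP; exists rs; rewrite // mP.
have /(similar_diagLR Su)[mu ME] := SP.
(* The rows of [S] are left eigenvectors; the basis sought consists of the columns of its
   inverse. *)
exists (invmx S), mu; rewrite unitmx_inv Su; split=> //.
by rewrite ME conjumx ?unitmx_inv.
Qed.

(** * Ordering the eigenvalues and their nonnegativity *)

Lemma rV_sort (R : realType) n (mu : 'rV[R]_n) :
  exists s : 'S_n, forall i j : 'I_n, (i <= j)%N -> mu 0 (s j) <= mu 0 (s i).
Proof.
pose t := [tuple mu 0 i | i < n].
have : perm_eq (sort >=%R t) t by rewrite perm_sort.
move=> /tuple_permP[s sE]; exists s => i j ij.
have := sort_sorted (@ge_total _ R) t; rewrite sE.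
move=> /(sorted_leq_nth ge_trans ge_refl 0)/(_ i j).
by rewrite !inE !size_tuple !ltn_ord -!tnth_nth !tnth_mktuple; exact.
Qed.

Lemma diagonalization_sort (R : realType) n (M S : 'M[R]_n) (mu : 'rV[R]_n) :
  S \in unitmx -> M = S *m diag_mx mu *m invmx S -> (forall i, 0 <= mu 0 i) ->
  exists (S' : 'M[R]_n) (k : nat) (mu' : 'rV[R]_n),
    sorted_diagonalization M S' k mu'.
Proof.
move=> Su ME mu_ge0; have [s s_dec] := rV_sort mu.
pose mu' := \row_i mu 0 (s i).
have mu'_dec (i j : 'I_n) : (i <= j)%N -> mu' 0 j <= mu' 0 i.
  by rewrite !mxE; exact: s_dec.
(* [k] is taken as the least index from which all sorted entries are nonpositive, hence zero. The
   tail at [n] is empty, which gives a first candidate and the bound on [k]. *)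
pose tail0 k := [forall i : 'I_n, (k <= i)%N ==> (mu' 0 i <= 0)].
have tail0n : tail0 n by apply/forallP => i; rewrite leqNgt ltn_ord.
case: (ex_minnP (ex_intro tail0 n tail0n)) => k /forallP k_tail k_min.
have mu'E : diag_mx mu *m perm_mx s^-1 = perm_mx s^-1 *m diag_mx mu'.
  apply/matrixP => i j; rewrite mul_diag_mx mul_mx_diag !mxE mulrC.
  by case: eqVneq => [<-|]; rewrite ?permKV ?mul0r.
have S'u : S *m perm_mx s^-1 \in unitmx by rewrite unitmx_mul Su unitmx_perm.
exists (S *m perm_mx s^-1), k, mu'; split=> //; last first.
  rewrite -(mulmxA S) -mu'E (mulmxA S).
  by rewrite -[S *m diag_mx mu](mulmxKV Su) -ME -(mulmxA M) mulmxK.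
split=> [|i j ij _|i ik|i ki]; [exact: k_min|exact: mu'_dec| |].
  (* A nonpositive entry at [i] would make the whole tail from [i] nonpositive, against the
     minimality of [k]. *)
  rewrite ltNge; apply/negP => mui; move: ik; rewrite ltnNge k_min//.
  by apply/forallP => j; apply/implyP => /mu'_dec/le_trans; exact.
apply/eqP; rewrite eq_le (implyP (k_tail i) ki) /=.
by rewrite mxE mu_ge0.
Qed.

(** For nonnegativity, let v be row i of S^-1, a left eigenvector. Then (v C0) H (v C0)^T = mu_i v
    C0 v^T, where the left side is nonnegative and v C0 v^T is positive. *)
Lemma infomx_diagonalization (R : realType) (m n : nat) (A : 'M[R]_(m, n))
    (Gamma : 'M[R]_m) (C0 : 'M[R]_n) :
  spdmx Gamma -> spdmx C0 ->
  exists (S : 'M[R]_n) (k : nat) (mu : 'rV[R]_n),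
    sorted_diagonalization (C0 *m infomx A Gamma) S k mu.
Proof.
move=> Gspd C0spd.
have [S [mu [Su ME]]] := selfadjoint_diagonalizable C0spd (infomx_sym A Gspd).
apply: (diagonalization_sort Su ME) => i; have [C0sym _] := C0spd.
pose v := row i (invmx S).
have vM : v *m (C0 *m infomx A Gamma) = mu 0 i *: v.
  rewrite ME -row_mul !mulmxA mulVmx// mul1mx.
  by apply/rowP => j; rewrite mul_diag_mx !mxE.
have v0 : v != 0.
  apply/eqP => v0; have : v *m S = 0 by rewrite v0 mul0mx.
  rewrite -row_mul mulVmx// => /rowP/(_ i)/eqP.
  by rewrite !mxE eqxx oner_eq0.
have := infomx_row_ge0 A Gspd (v *m C0).
rewrite trmx_mul C0sym -(mulmxA v) vM -!scalemxAl mulmxA mxE.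
by rewrite pmulr_lge0// spdmx_row.
Qed.

(** * Entrywise limits and derivatives of matrix functions *)

Lemma cvg_mxP (R : realType) (T : Type) (F : set_system T) {FF : Filter F}
    p n (M : T -> 'M[R]_(p, n)) (L : 'M[R]_(p, n)) :
  M x @[x --> F] --> L <-> forall i j, M x i j @[x --> F] --> L i j.
Proof.
split=> [ML i j|ML].
  apply: (@cvg_comp _ _ _ M (fun A : 'M[R]_(p, n) => A i j) F (nbhs L)
    (nbhs (L i j)) ML).
  exact: coord_continuous.
apply/cvgrPdist_le => /= e e0; near=> x.
rewrite /Num.Def.normr/= mx_normrE (bigmax_le _ (ltW e0))//= => i _.
rewrite !mxE/=; move: i; near: x; apply: filter_forall => /= i.
exact: ((cvgrPdist_le _ _).1 (ML i.1 i.2)).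
Unshelve. all: by end_near. Qed.

Lemma is_derive_mxP (R : realType) p n (M : R -> 'M[R]_(p, n))
    (dM : 'M[R]_(p, n)) (t : R) :
  is_derive t 1 M dM <->
  forall i j, is_derive t 1 (fun x => M x i j) (dM i j).
Proof.
split=> [[dvM <-] i j|dvM].
  by split; [exact: (derivable_mxP _ _ _).1|rewrite derive_mx// mxE].
have Mt : derivable M t 1.
  by apply/derivable_mxP => i j; case: (dvM i j).
split=> //; rewrite derive_mx//; apply/matrixP => i j; rewrite mxE.
by case: (dvM i j).
Qed.

Lemma is_derive_bigsum (R : realType) n (f : 'I_n -> R -> R) (df : 'I_n -> R)
    (t : R) :
  (forall i, is_derive t 1 (f i) (df i)) ->
  is_derive t 1 (fun x => \sum_(i < n) f i x) (\sum_(i < n) df i).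
Proof.
move=> fdf; have -> : (fun x => \sum_(i < n) f i x) = \sum_(i < n) f i.
  by apply/funext => x; rewrite fct_sumE.
exact: (is_derive_sum fdf).
Qed.

Lemma is_derive_mulmx (R : realType) p n q (M : R -> 'M[R]_(p, n))
    (N : R -> 'M[R]_(n, q)) dM dN (t : R) :
  is_derive t 1 M dM -> is_derive t 1 N dN ->
  is_derive t 1 (fun x => M x *m N x) (dM *m N t + M t *m dN).
Proof.
move=> /is_derive_mxP MdM /is_derive_mxP NdN; apply/is_derive_mxP => i j.
under eq_fun do rewrite mxE.
rewrite !mxE -big_split /=; apply: is_derive_bigsum => k.
apply: is_derive_eq (is_deriveM (MdM i k) (NdN k j)) _.
by rewrite /GRing.scale /=; ring.
Qed.

Lemma cvg_sumR (R : realType) (T : Type) (F : set_system T) {FF : Filter F}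
    n (f : 'I_n -> T -> R) (l : 'I_n -> R) :
  (forall i, f i x @[x --> F] --> l i) ->
  \sum_(i < n) f i x @[x --> F] --> \sum_(i < n) l i.
Proof. by move=> fl; apply: (cvg_big add_continuous) => // i _; exact: fl. Qed.

Lemma cvg_mulmx (R : realType) (T : Type) (F : set_system T) {FF : Filter F}
    p n q (M : T -> 'M[R]_(p, n)) (N : T -> 'M[R]_(n, q))
    (K : 'M[R]_(p, n)) (L : 'M[R]_(n, q)) :
  M x @[x --> F] --> K -> N x @[x --> F] --> L ->
  M x *m N x @[x --> F] --> K *m L.
Proof.
move=> /cvg_mxP MK /cvg_mxP NL; apply/cvg_mxP => i j.
under eq_fun do rewrite mxE.
by rewrite mxE; apply: cvg_sumR => k; exact: cvgM.
Qed.

(** * Gronwall's inequality and uniqueness for linear equations *)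

(** The integrating factor [expR (- K * t)] turns the differential inequality into a nonpositive
    derivative, so [h] is nonincreasing on [0, T]. *)
Lemma gronwall_le0 (R : realType) (g dg : R -> R) (K T : R) :
  0 < T -> {within `[0, T], continuous g} ->
  (forall t, t \in `]0, T[ -> is_derive t 1 g (dg t)) ->
  (forall t, t \in `]0, T[ -> dg t <= K * g t) ->
  g 0 <= 0 -> g T <= 0.
Proof.
move=> T0 gC gD dgK g0.
pose h t := g t * expR (- K * t).
have eD (t : R) :
    is_derive t 1 (fun t => expR (- K * t)) (- K * expR (- K * t)).
  have lD : is_derive t 1 ((- K) \*: (@id R)) (- K *: 1) :=
    is_deriveZ (- K) (is_derive_id t 1).
  have := @is_derive1_comp R expR _ t _ _ (is_derive_expR _) lD.
  by rewrite /GRing.scale /= mulr1 mulrC.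
have hD t : t \in `]0, T[ ->
    is_derive t 1 h ((dg t - K * g t) * expR (- K * t)).
  move=> tT; apply: is_derive_eq (is_deriveM (gD t tT) (eD t)) _.
  by rewrite /GRing.scale /=; ring.
have : h T <= h 0.
  apply: (@ler0_derive1_nincr _ _ 0 T) => //; rewrite ?ltW//.
  - by move=> t /hD[].
  - move=> t tT; rewrite derive1E; have [_ ->] := hD _ tT.
    by rewrite pmulr_lle0 ?expR_gt0// subr_le0 dgK.
  - move=> t; apply: cvgM; first exact: gC.
    move: t; apply: continuous_subspaceT => t.
    by apply/differentiable_continuous/derivable1_diffP; case: (eD t).
rewrite /h mulr0 expR0 mulr1 => hT; have := le_trans hT g0.
by rewrite pmulr_lle0// expR_gt0.
Qed.

(** Only a right limit is asked at 0, since a solution is arbitrary at negative times. *)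
Lemma within_continuous_right0 (R : realType) (f : R -> R) (T : R) :
  0 < T -> (forall t, 0 < t -> {for t, continuous f}) ->
  f x @[x --> 0^'+] --> f 0 -> {within `[0, T], continuous f}.
Proof.
move=> T0 fC f0; apply/continuous_within_itvP => //; split=> //.
  by move=> t; rewrite in_itv /= => /andP[t0 _]; exact: fC.
exact/cvg_at_left_filter/fC.
Qed.

Lemma mx_entry_le_norm (R : realType) p n (M : 'M[R]_(p, n)) i j :
  `|M i j| <= `|M|.
Proof.
rewrite [leRHS]/Num.Def.normr/= mx_normrE.
exact: (le_bigmax _ (fun ij => `|M ij.1 ij.2|) (i, j)).
Qed.

(** Each product [2 * W i j * W i k * B k j] is at most [b * (W i j ^+ 2 + W i k ^+ 2)]. Summed over
    [j] and [k], each square occurs [n] times from either term, whence the constant. *)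
Lemma linear_growth_bound (R : realType) p n (W : 'M[R]_(p, n)) (B : 'M[R]_n)
    (b : R) :
  (forall k j, `|B k j| <= b) ->
  \sum_i \sum_j 2 * W i j * (W *m B) i j
    <= (2 * b * n%:R) * \sum_i \sum_j W i j ^+ 2.
Proof.
move=> Bb; rewrite mulr_sumr; apply: ler_sum => i _.
have -> : 2 * b * n%:R * \sum_j W i j ^+ 2
    = \sum_j \sum_k b * (W i j ^+ 2 + W i k ^+ 2).
  under [RHS]eq_bigr do rewrite -mulr_sumr big_split /= sumr_const card_ord.
  rewrite -mulr_sumr big_split /= sumr_const card_ord sumrMnl.
  by ring.
apply: ler_sum => j _; rewrite mxE mulr_sumr; apply: ler_sum => k _.
have Bkj : -b <= B k j <= b by rewrite -ler_norml.
move: (W i j) (W i k) (B k j) Bkj => x y z /andP[bz zb].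
(* The two products add up to 2b(x^2 + y^2) - 4xyz. *)
have : 0 <= (b - z) * (x + y) ^+ 2 by rewrite mulr_ge0 ?sqr_ge0 ?subr_ge0.
have : 0 <= (b + z) * (x - y) ^+ 2.
  by rewrite mulr_ge0 ?sqr_ge0// -[b]opprK addrC subr_ge0.
nra.
Qed.

Lemma linear_ode_zero (R : realType) p n (W : R -> 'M[R]_(p, n))
    (B : R -> 'M[R]_n) :
  (forall t : R, 0 < t -> is_derive t 1 W (W t *m B t)) ->
  W x @[x --> 0^'+] --> W 0 ->
  (forall t : R, 0 < t -> {for t, continuous B}) -> B x @[x --> 0^'+] --> B 0 ->
  W 0 = 0 -> forall T : R, 0 <= T -> W T = 0.
Proof.
move=> WD W0C BC B0C W0 T; rewrite le_eqVlt => /predU1P[<-//|T0].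
have nBC : {within `[0, T], continuous (fun t => `|B t|)}.
  apply: within_continuous_right0 => // [t t0|]; last exact: cvg_norm.
  by apply: cvg_norm; exact: BC.
(* The maximum of the norm of [B] on the compact interval gives one growth constant for all times up
   to [T]. *)
have [c _ Bc] := EVT_max (ltW T0) nBC.
pose g (t : R) := \sum_i \sum_j W t i j ^+ 2.
have gD (t : R) : 0 < t ->
    is_derive t 1 g (\sum_i \sum_j 2 * W t i j * (W t *m B t) i j).
  move=> t0; apply: is_derive_bigsum => i; apply: is_derive_bigsum => j.
  have Wij := (is_derive_mxP _ _ _).1 (WD t t0) i j.
  apply: is_derive_eq (is_deriveX 2 Wij) _.
  by rewrite /GRing.scale /= expr1.
have : g T <= 0.
  apply: (@gronwall_le0 _ g
    (fun t => \sum_i \sum_j 2 * W t i j * (W t *m B t) i j) (2 * `|B c| * n%:R)) => //.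
  - apply: within_continuous_right0 => // [t t0|].
      by apply/differentiable_continuous/derivable1_diffP; case: (gD t t0).
    apply: cvg_sumR => i; apply: cvg_sumR => j.
    by apply: cvgM; apply: (cvg_mxP _ _).1.
  - by move=> t; rewrite in_itv /= => /andP[t0 _]; exact: gD.
  - move=> t tT; apply: linear_growth_bound => k j.
    apply: le_trans (mx_entry_le_norm _ _ _) _; apply: Bc.
    exact: subset_itv_oo_cc.
  - rewrite /g big1// => i _; rewrite big1// => j _.
    by rewrite W0 mxE expr0n.
move=> gT; apply/matrixP => i j; rewrite mxE; apply/eqP.
rewrite -sqrf_eq0 eq_le sqr_ge0 andbT; apply: le_trans gT.
rewrite /g (bigD1 i)//= (bigD1 j)//= -addrA lerDl.
by rewrite addr_ge0// !sumr_ge0// => k _;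
  rewrite ?sqr_ge0// sumr_ge0// => l _; rewrite sqr_ge0.
Qed.

Lemma is_derive_affine (R : realType) (c a b t : R) :
  is_derive t 1 (fun x => c + a * x * b) (a * b).
Proof.
have -> : (fun x => c + a * x * b) = cst c + (a * b) \*: (@id R).
  by apply/funext => x; rewrite fctE /= /GRing.scale /=; ring.
apply: is_derive_eq
  (is_deriveD (is_derive_cst c t 1) (is_deriveZ (a * b) (is_derive_id t 1))) _.
by rewrite add0r /GRing.scale /= mulr1.
Qed.

Lemma derivable_mx_continuous (R : realType) p n (M : R -> 'M[R]_(p, n)) dM
    (t : R) :
  is_derive t 1 M dM -> {for t, continuous M}.
Proof.
by case=> Mt _; exact/differentiable_continuous/derivable1_diffP.
Qed.

(** * The Riccati flow in the eigenbasis *)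

Section Diagonalized.
Variables (R : realType) (m n : nat) (A : 'M[R]_(m, n)) (Gamma : 'M[R]_m).
Variables (C0 : 'M[R]_n) (alpha : R).
Variables (S : 'M[R]_n) (k : nat) (mu : 'rV[R]_n).
Implicit Types t : R.
Hypothesis (alpha_gt0 : 0 < alpha).
Hypothesis (diagM : sorted_diagonalization (C0 *m infomx A Gamma) S k mu).

Let H := infomx A Gamma.
Let C := cov A Gamma C0 alpha.

Lemma spectrum_ge0 i : 0 <= mu 0 i.
Proof.
have [_ [_ _ mu_gt0 mu0] _] := diagM.
by have [/mu_gt0/ltW|/mu0->] := ltnP i k.
Qed.

Lemma denom_gt0 t i : 0 <= t -> 0 < 1 + alpha * t * mu 0 i.
Proof.
move=> t0; apply: ltr_pwDl => //.
by rewrite !mulr_ge0 ?spectrum_ge0 ?(ltW alpha_gt0).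
Qed.

Lemma cov_denomE t :
  cov_denom A Gamma C0 alpha t
    = S *m diag_mx (\row_i (1 + alpha * t * mu 0 i)) *m invmx S.
Proof.
have [Su _ ME] := diagM.
have -> : diag_mx (\row_i (1 + alpha * t * mu 0 i))
    = 1%:M + (alpha * t) *: diag_mx mu.
  apply/matrixP => i j; rewrite !mxE.
  by case: eqVneq => [->|]; rewrite ?mulr1n ?mulr0n ?mulr0 ?addr0.
rewrite mulmxDr mulmx1 mulmxDl mulmxV// -scalemxAr -scalemxAl.
by rewrite /cov_denom ME.
Qed.

(** The determinant is that of the diagonal factor, a product of positive numbers when [0 <= t].
    Hence [invmx] is a true inverse there. *)
Lemma cov_denom_unit t : 0 <= t -> cov_denom A Gamma C0 alpha t \in unitmx.
Proof.
move=> t0; have [Su _ _] := diagM.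
rewrite cov_denomE !unitmx_mul unitmx_inv Su andbT /= unitmxE det_diag.
rewrite unitfE; apply/prodf_neq0 => i _.
by rewrite mxE gt_eqF// denom_gt0.
Qed.

Lemma covE t : 0 <= t -> C t = S *m Emx alpha mu t *m invmx S *m C0.
Proof.
move=> t0; have [Su _ _] := diagM; rewrite /C /cov; congr (_ *m _).
rewrite -[invmx _]mulmx1; apply: (canLR (mulKmx (cov_denom_unit t0))).
rewrite cov_denomE !mulmxA mulmxKV// -(mulmxA S) mulmx_diag.
have -> : diag_mx (\row_j ((\row_i (1 + alpha * t * mu 0 i)) 0 j
    * (\row_i (1 + alpha * t * mu 0 i)^-1) 0 j)) = 1%:M :> 'M[R]_n.
  apply/matrixP => i j; rewrite !mxE mulfV//.
  by rewrite gt_eqF// denom_gt0.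
by rewrite mulmx1 mulmxV.
Qed.

Lemma DmxE t :
  Dmx alpha mu t = diag_mx (\row_i (mu 0 i / (1 + alpha * t * mu 0 i))).
Proof.
rewrite /Dmx mulmx_diag; congr diag_mx.
by apply/rowP => i; rewrite !mxE.
Qed.

Lemma cov_infomxE t : 0 <= t -> C t *m H = S *m Dmx alpha mu t *m invmx S.
Proof.
move=> t0; have [Su _ ME] := diagM.
rewrite covE// -(mulmxA _ C0) ME !mulmxA mulmxKV// -(mulmxA S).
by rewrite /Dmx /Emx (diag_mxC _ mu) !mulmxA.
Qed.

Lemma infomx_covE t : 0 <= t ->
  C0 *m H *m C t = S *m Dmx alpha mu t *m invmx S *m C0.
Proof.
move=> t0; have [Su _ ME] := diagM.
by rewrite covE// ME !mulmxA mulmxKV// /Dmx !mulmxA.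
Qed.

(** On the diagonal, 1 / (1 + alpha t mu) has derivative -alpha mu / (1 + alpha t mu)^2. *)
Lemma Emx_derive t : 0 <= t ->
  is_derive t 1 (Emx alpha mu)
    (- (alpha *: (Dmx alpha mu t *m Emx alpha mu t))).
Proof.
move=> t0; apply/is_derive_mxP => i j.
rewrite DmxE mulmx_diag !mxE.
under eq_fun do rewrite !mxE.
case: (i == j); rewrite ?mulr0n ?mulr1n; last first.
  by rewrite mulr0 oppr0; exact: is_derive_cst.
have dn0 : 1 + alpha * t * mu 0 i != 0 by rewrite gt_eqF// denom_gt0.
have aff := is_derive_affine 1 alpha (mu 0 i) t.
apply: is_derive_eq (@is_deriveV _ _ t _ _ dn0 aff) _.
by rewrite /GRing.scale /=; field.
Qed.

(** The diagonal formula as a function on the whole line. It has a two-sided derivative even at 0,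
    and its equation is carried over to [C] where [0 <= t]. *)
Let Ct t := S *m Emx alpha mu t *m (invmx S *m C0).

Let covCt t : 0 <= t -> C t = Ct t.
Proof. by move=> t0; rewrite covE// /Ct !mulmxA. Qed.

Lemma Ct_derive t : 0 <= t ->
  is_derive t 1 Ct (- (alpha *: (Ct t *m H *m Ct t))).
Proof.
move=> t0; have [Su _ _] := diagM.
have CtH : Ct t *m H = S *m Dmx alpha mu t *m invmx S.
  by rewrite -covCt// cov_infomxE.
have SE := is_derive_mulmx (is_derive_cst S t 1) (Emx_derive t0).
apply: is_derive_eq
  (is_derive_mulmx SE (is_derive_cst (invmx S *m C0) t 1)) _.
rewrite mulmx0 addr0 mul0mx add0r CtH.
rewrite /Ct !mulmxA mulmxKV// mulmxN mulNmx -scalemxAr -scalemxAl.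
by rewrite mulNmx -scalemxAl !mulmxA.
Qed.

Lemma cov_riccati : riccati_solution A Gamma C0 alpha C.
Proof.
have C_0 : C 0 = C0.
  rewrite /C /cov /cov_denom mulr0 scale0r addr0.
  by rewrite -[RHS]mul1mx; congr (_ *m _); rewrite invmx1.
split=> [//||t t0].
- rewrite covCt//; have [dCt DCt] := Ct_derive (lexx 0).
  (* The two-sided derivative of [Ct] at 0 is restricted to positive increments, where [Ct] agrees
     with [C]. *)
  have /cvg_dnbhs_at_right : h^-1 *: ((Ct \o shift 0) (h *: 1) - Ct 0)
      @[h --> (0 : R)^'] --> 'D_1 Ct 0 := dCt.
  rewrite DCt; apply: cvg_trans; apply: near_eq_cvg; near=> h.
  have h0 : 0 < h by near: h; exact: nbhs_right_gt.
  by rewrite /= (covCt (ltW h0)) addr0 /GRing.scale /= mulr1.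
- rewrite covCt ?ltW//; apply: near_eq_is_derive (Ct_derive (ltW t0)).
  near=> x; rewrite covCt// ltW//; near: x.
  exact: lt_nbhsr.
Unshelve. all: by end_near. Qed.

Lemma Emx_cvg : Emx alpha mu t @[t --> +oo] --> Einfmx R n k.
Proof.
have [_ [_ _ mu_gt0 mu0] _] := diagM.
apply/cvg_mxP => i j; rewrite !mxE; under eq_fun do rewrite !mxE.
case: (i == j); rewrite ?mulr0n ?mulr1n; last exact: cvg_cst.
have [ik|ki] := ltnP i k; last first.
  by rewrite mu0//; under eq_fun do rewrite mulr0 addr0 invr1; exact: cvg_cst.
have a0 : 0 < alpha * mu 0 i by rewrite mulr_gt0 ?mu_gt0.
apply/cvgrPdist_le => /= e e0; near=> t.
(* Beyond this threshold e alpha mu t is at least 1, so 1 / (1 + alpha t mu) is at most e. *)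
have te : (e * (alpha * mu 0 i))^-1 <= t.
  by near: t; apply: nbhs_pinfty_ge; rewrite num_real.
have t0 : 0 < t by apply: lt_le_trans te; rewrite invr_gt0 mulr_gt0.
have dt0 := denom_gt0 i (ltW t0).
rewrite sub0r normrN gtr0_norm ?invr_gt0// -div1r ler_pdivrMr//.
have : 1 <= e * (alpha * mu 0 i) * t.
  by rewrite -ler_pdivrMl ?mulr1// mulr_gt0.
move=> /le_trans; apply; rewrite mulrDr mulr1 !mulrA.
rewrite [leLHS](_ : _ = e * alpha * t * mu 0 i); last by ring.
by rewrite lerDr ltW.
Unshelve. all: by end_near. Qed.

Lemma cov_cvg : C t @[t --> +oo] --> S *m Einfmx R n k *m invmx S *m C0.
Proof.
have : Ct t @[t --> +oo] --> S *m Einfmx R n k *m (invmx S *m C0).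
  apply: cvg_mulmx; last exact: cvg_cst.
  by apply: cvg_mulmx; [exact: cvg_cst|exact: Emx_cvg].
rewrite mulmxA; apply: cvg_trans; apply: near_eq_cvg; near=> t.
rewrite -covCt//; near: t; apply: nbhs_pinfty_ge; exact: real0.
Unshelve. all: by end_near. Qed.

(** As [C0] is invertible, it suffices that C0 H S E_oo = S D E_oo vanishes; D is zero exactly where
    E_oo is not. *)
Lemma infomx_Einf : spdmx C0 -> H *m (S *m Einfmx R n k) = 0.
Proof.
move=> /spdmx_unit C0u; have [Su [_ _ _ mu0] ME] := diagM.
apply: (can_inj (mulKmx C0u)); rewrite mulmx0 (mulmxA C0) ME mulmxA mulmxKV//.
rewrite -mulmxA mulmx_diag.
suff -> : diag_mx (\row_j (mu 0 j * (\row_(i < n) (k <= i)%N%:R) 0 j))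
    = 0 :> 'M[R]_n.
  by rewrite mulmx0.
apply/matrixP => i j; rewrite !mxE.
by have [/mu0->|_] := leqP k i; rewrite ?mul0r ?mulr0 mul0rn.
Qed.

Lemma riccati_unique X : riccati_solution A Gamma C0 alpha X ->
  forall t, 0 <= t -> X t = C t.
Proof.
move=> [X0 X0D XD].
pose F := cov_denom A Gamma C0 alpha.
(* For [0 <= t] the matrix [F t] is invertible, so [W t = 0] says exactly that [X t] is [C t]. *)
pose W t := F t *m X t - C0.
pose B t := (- alpha *: H) *m X t.
have FD t : is_derive t 1 F (alpha *: (C0 *m H)).
  apply/is_derive_mxP => i j; rewrite [X in is_derive _ _ _ X]mxE.
  have -> : (fun x => F x i j) = fun x => 1%:M i j + alpha * x * (C0 *m H) i j.
    by apply/funext => x; rewrite /F /cov_denom mxE [X in _ + X]mxE.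
  exact: is_derive_affine.
(* Right continuity at 0 follows from the one-sided derivative: X(h) is X(0) plus h times a
   convergent difference quotient. *)
have X0C : X x @[x --> 0^'+] --> X 0.
  have idC : h @[h --> (0 : R)^'+] --> (0 : R).
    exact: cvg_at_right_filter cvg_id.
  have : X 0 + h *: (h^-1 *: (X h - X 0)) @[h --> (0 : R)^'+]
      --> X 0 + 0 *: - (alpha *: (X 0 *m H *m X 0)).
    by apply: cvgD; [exact: cvg_cst|exact: cvgZ].
  rewrite scale0r addr0.
  apply: cvg_trans; apply: near_eq_cvg; near=> h.
  have h0 : h != 0 by rewrite gt_eqF//; near: h; exact: nbhs_right_gt.
  by rewrite /= scalerA mulfV// scale1r addrC subrK.
have W0 : W 0 = 0.
  by rewrite /W /F X0 /cov_denom mulr0 scale0r addr0 mul1mx subrr.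
have WT : forall T : R, 0 <= T -> W T = 0.
  apply: (@linear_ode_zero _ _ _ W B); last exact: W0.
  - move=> t t0.
    (* The product rule gives F' X + F X' = alpha C0 H X - alpha F X H X, which is [W t *m B t]. *)
    apply: is_derive_eq
      (is_deriveB (is_derive_mulmx (FD t) (XD t t0)) (is_derive_cst C0 t 1)) _.
    rewrite subr0 /W /B mulmxBl mulmxN -scalemxAr -!scalemxAl.
    rewrite -!scalemxAr !scaleNr opprK addrC !mulmxA.
    by [].
  - apply: cvgB; last exact: cvg_cst.
    apply: cvg_mulmx => //; apply: cvg_at_right_filter.
    exact: derivable_mx_continuous (FD 0).
  - move=> t t0; apply: cvg_mulmx; first exact: cvg_cst.
    exact: derivable_mx_continuous (XD t t0).
  - by apply: cvg_mulmx => //; exact: cvg_cst.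
move=> t t0; rewrite /C /cov; apply: (canRL (mulKmx (cov_denom_unit t0))).
by apply/eqP; rewrite -subr_eq0; exact/eqP/WT.
Unshelve. all: by end_near. Qed.

End Diagonalized.

Theorem theorem2p1 (R : realType) (m n : nat) (A : 'M[R]_(m, n))
    (Gamma : 'M[R]_m) (C0 : 'M[R]_n) (alpha : R)
    (hGamma : spdmx Gamma) (hC0 : spdmx C0) (halpha : 0 < alpha) :
  let C := cov A Gamma C0 alpha in
  let Cinf := lim (C t @[t --> +oo]) in
  (* C is well defined on [0, +oo[ and is the solution of the ODE there *)
  [/\ forall t : R, 0 <= t -> cov_denom A Gamma C0 alpha t \in unitmx,
      riccati_solution A Gamma C0 alpha C &
      forall X : R -> 'M[R]_n, riccati_solution A Gamma C0 alpha X ->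
        forall t : R, 0 <= t -> X t = C t]
  /\
  (* (i) *)
  (exists (S : 'M[R]_n) (k : nat) (mu : 'rV[R]_n),
      sorted_diagonalization (C0 *m infomx A Gamma) S k mu)
  /\
  (* (ii) and (iii), for every diagonalization as in (i) *)
  (forall (S : 'M[R]_n) (k : nat) (mu : 'rV[R]_n),
      sorted_diagonalization (C0 *m infomx A Gamma) S k mu ->
      (forall t : R, 0 <= t ->
        [/\ Dmx alpha mu t =
              diag_mx (\row_i (mu 0 i / (1 + alpha * t * mu 0 i))),
            C t = S *m Emx alpha mu t *m invmx S *m C0,
            C t *m infomx A Gamma = S *m Dmx alpha mu t *m invmx S &
            C0 *m infomx A Gamma *m C t
              = S *m Dmx alpha mu t *m invmx S *m C0])
      /\
      [/\ C t @[t --> +oo] --> Cinf,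
          Cinf = S *m Einfmx R n k *m invmx S *m C0 &
          A *m Cinf = 0]).
Proof.
move=> C Cinf; rewrite {}/Cinf.
(* The claims on the equation do not mention [S], so any one diagonalization serves for them. *)
have [S0 [k0 [mu0 diag0]]] := infomx_diagonalization A hGamma hC0.
split; last split.
- split=> [t t0||X Xsol t t0].
  + exact: (cov_denom_unit halpha diag0 t0).
  + exact: (cov_riccati halpha diag0).
  + exact: (riccati_unique halpha diag0 Xsol t0).
- by exists S0, k0, mu0.
- move=> S k mu diagM; split=> [t t0|].
    split; [exact: DmxE|exact: (covE halpha diagM t0)|exact: (cov_infomxE halpha diagM t0)|].
    exact: (infomx_covE halpha diagM t0).
  have Ccvg := cov_cvg halpha diagM.
  (* [lim] is identified through the proved convergence and the uniqueness of limits in a Hausdorff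
     space. *)
  have CinfE : lim (C t @[t --> +oo]) = S *m Einfmx R n k *m invmx S *m C0.
    exact: (cvg_lim (@norm_hausdorff _ _) Ccvg).
  split; [by rewrite CinfE|exact: CinfE|].
  rewrite CinfE !mulmxA -(mulmxA A).
  by rewrite (infomx_mul_eq0 hGamma (infomx_Einf diagM hC0)) !mul0mx.
Qed.
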